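(* Let $w^\dagger:\mathcal S\to\mathcal A$ be a policy, let $\tilde c\in\mathbb{R}^{S\times A}$ be a falsified cost matrix, and let $\tilde Q^*\in\mathbb{R}^{S\times A}$ be the $Q$-values learned from the $Q$-learning algorithm with cost $\tilde c$. Then $\tilde Q^*\in\mathcal V_{w^\dagger}$ if and only if $$\tilde c(i,a)>(\mathbf 1_i-\beta P_{ia})^T(I-\beta P_{w^\dagger})^{-1}\tilde c_{w^\dagger}$$ for all $i\in\mathcal S$ and all $a\in\mathcal A\setminus\{w^\dagger(i)\}$.
   Context: Finite Markov decision process: $\mathcal S=\{1,\dots,S\}$ is a finite state space, $\mathcal A=\{a_1,\dots,a_A\}$ a finite action space, $p(i,j,a)$ is the probability of moving from state $i$ to state $j$ under action $a$ (so $p(i,j,a)\ge 0$, $\sum_j p(i,j,a)=1$), and $\beta\in(0,1)$ is the discount factor. The $Q$-values learned with cost $\tilde c$ are the (almost sure) limit of the $Q$-learning algorithm run with cost $\tilde c$, i.e. the unique $Q\in\mathbb{R}^{S\times A}$ satisfying $$Q(i,a)=\tilde c(i,a)+\beta\sum_{j\in\mathcal S}p(i,j,a)\min_{b\in\mathcal A}Q(j,b)\quad\text{for all } i\in\mathcal S,\ a\in\mathcal A.$$ For a policy $w:\mathcal S\to\mathcal A$: $\mathcal V_w=\{Q\in\mathbb{R}^{S\times A}: Q(i,w(i))<Q(i,a)\ \forall i\in\mathcal S,\ \forall a\ne w(i)\}$; $P_w\in\mathbb{R}^{S\times S}$ has entries $[P_w]_{i,j}=p(i,j,w(i))$; $\tilde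 c_w\in\mathbb{R}^S$ is the vector whose $i$th component is $\tilde c(i,w(i))$. Moreover $P_{ia}=(p(i,1,a),\dots,p(i,S,a))^T\in\mathbb{R}^S$, $\mathbf 1_i\in\mathbb{R}^S$ is the $i$th standard basis vector, and $I$ is the $S\times S$ identity matrix. *)

(* Defs.v *)
From mathcomp Require Import all_boot all_order all_algebra.
From mathcomp Require Import classical_sets reals.

Set Implicit Arguments.
Unset Strict Implicit.
Unset Printing Implicit Defensive.

Import Order.TTheory GRing.Theory Num.Theory.

Local Open Scope classical_set_scope.
Local Open Scope ring_scope.

(* Both spaces are nonempty: there are [S.+1] states and [A.+1] actions.
   [p i j a] is the probability of moving from [i] to [j] under [a]. *)
Definition transition_kernel (R : realType) (S A : nat)
    (p : 'I_S.+1 -> 'I_S.+1 -> 'I_A.+1 -> R) : Prop :=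
  (forall i j a, 0 <= p i j a) /\ (forall i a, \sum_j p i j a = 1).

(* The default value of the iterated minimum is itself one of the entries
   [Q j b], so this is exactly the minimum over all actions. *)
Definition min_action (R : realType) (S A : nat)
    (Q : 'M[R]_(S.+1, A.+1)) (j : 'I_S.+1) : R :=
  \big[Num.min/Q j ord0]_(b < A.+1) Q j b.

(* The limit of Q-learning with cost [c] is the solution of the Bellman
   optimality equation, which is unique when [p] is a transition kernel and
   [0 < beta < 1]; uniqueness is deliberately not part of the predicate. *)
Definition learned_Qvalues (R : realType) (S A : nat)
    (p : 'I_S.+1 -> 'I_S.+1 -> 'I_A.+1 -> R) (beta : R)
    (c Q : 'M[R]_(S.+1, A.+1)) : Prop :=
  forall i a, Q i a = c i a + beta * \sum_j p i j a * min_action Q j.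

Definition policy_region (R : realType) (S A : nat)
    (w : 'I_S.+1 -> 'I_A.+1) : set 'M[R]_(S.+1, A.+1) :=
  [set Q | forall i a, a != w i -> Q i (w i) < Q i a].

Definition policy_transition (R : realType) (S A : nat)
    (p : 'I_S.+1 -> 'I_S.+1 -> 'I_A.+1 -> R) (w : 'I_S.+1 -> 'I_A.+1) :
    'M[R]_S.+1 :=
  \matrix_(i, j) p i j (w i).

Definition policy_cost (R : realType) (S A : nat)
    (c : 'M[R]_(S.+1, A.+1)) (w : 'I_S.+1 -> 'I_A.+1) : 'cV[R]_S.+1 :=
  \col_i c i (w i).

Definition transition_vector (R : realType) (S A : nat)
    (p : 'I_S.+1 -> 'I_S.+1 -> 'I_A.+1 -> R) (i : 'I_S.+1) (a : 'I_A.+1) :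
    'cV[R]_S.+1 :=
  \col_j p i j a.

Definition std_basis (R : realType) (S : nat) (i : 'I_S.+1) : 'cV[R]_S.+1 :=
  delta_mx i 0.

(* Main.v *)
(* Put V = (I - beta P_w)^-1 c_w, the value of the policy w, and let
   m(i) = min_a Q(i,a).  Since P_w is stochastic and beta < 1, V is the only
   fixed point of x |-> c_w + beta P_w x, and the displayed condition reads
   V(i) < c(i,a) + beta sum_j p(i,j,a) V(j).  Both directions reduce to m = V.
   If Q lies in V_w, then m(i) = Q(i,w(i)), so m is such a fixed point.
   Conversely, m - V <= beta P_w (m - V) always holds, and the condition gives
   V - m <= beta P_u (V - m) for a policy u greedy for Q; the maximum principle
   for discounted stochastic matrices turns both into m = V. *)

Require Import Defs.
From mathcomp Require Import all_boot all_order all_algebra.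
From mathcomp Require Import classical_sets reals.
From mathcomp Require Import lra.

Set Implicit Arguments.
Unset Strict Implicit.
Unset Printing Implicit Defensive.

Import Order.TTheory GRing.Theory Num.Theory.

Local Open Scope classical_set_scope.
Local Open Scope ring_scope.

(** At an index [k] where [x] is largest, the average [\sum_j P k j * x j] is at most [x k], so
    [(1 - beta) * x k <= 0]. *)
Lemma discounted_max_principle (R : realFieldType) (n : nat) (beta : R)
    (P : 'I_n.+1 -> 'I_n.+1 -> R) (x : 'I_n.+1 -> R) :
    0 <= beta -> beta < 1 ->
    (forall i j, 0 <= P i j) -> (forall i, \sum_j P i j = 1) ->
    (forall i, x i <= beta * \sum_j P i j * x j) ->
  forall i, x i <= 0.
Proof.
move=> b0 b1 P0 P1 xle i.
have [k kmax] : exists k, forall j, x j <= x k.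
  have [k _ kmax] := @arg_maxP _ _ _ ord0 xpredT x isT.
  by exists k => j; exact: kmax.
apply: (le_trans (kmax i)).
have : \sum_j P k j * x j <= x k.
  rewrite -[leRHS]mul1r -(P1 k) mulr_suml.
  by apply: ler_sum => j _; rewrite ler_wpM2l // kmax.
move=> /(ler_wpM2l b0) /(le_trans (xle k)) xk.
have b1_gt0 : 0 < 1 - beta by rewrite subr_gt0.
by rewrite -(pmulr_rle0 _ b1_gt0) mulrBl mul1r subr_le0.
Qed.

(** In the difference of two solutions the cost cancels, so the maximum principle bounds it by 0;
    exchanging the solutions gives equality. *)
Lemma discounted_fixpoint_eq (R : realFieldType) (n : nat) (beta : R)
    (P : 'I_n.+1 -> 'I_n.+1 -> R) (c x y : 'I_n.+1 -> R) :
    0 <= beta -> beta < 1 ->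
    (forall i j, 0 <= P i j) -> (forall i, \sum_j P i j = 1) ->
    (forall i, x i = c i + beta * \sum_j P i j * x j) ->
    (forall i, y i = c i + beta * \sum_j P i j * y j) ->
  x =1 y.
Proof.
move=> b0 b1 P0 P1.
suff half u v : (forall i, u i = c i + beta * \sum_j P i j * u j) ->
    (forall i, v i = c i + beta * \sum_j P i j * v j) -> forall i, u i <= v i.
  by move=> xE yE i; apply/le_anti; rewrite !half.
move=> uE vE i; rewrite -subr_le0.
apply: (discounted_max_principle (x := fun i => u i - v i) b0 b1 P0 P1) => k.
rewrite uE vE opprD addrACA subrr add0r -mulrBr -sumrB.
by under eq_bigr do rewrite -mulrBr.
Qed.

(** A kernel vector is a fixed point for zero cost, and so is 0. The transpose enters because
    [row_free] concerns row vectors multiplied on the left. *)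
Lemma discounted_unitmx (R : realFieldType) (n : nat) (beta : R) (P : 'M[R]_n.+1) :
    0 <= beta -> beta < 1 ->
    (forall i j, 0 <= P i j) -> (forall i, \sum_j P i j = 1) ->
  1%:M - beta *: P \in unitmx.
Proof.
move=> b0 b1 P0 P1; rewrite -unitmx_tr -row_free_unit.
apply/inj_row_free => v /(congr1 trmx).
rewrite trmx_mul trmxK trmx0 mulmxBl mul1mx -scalemxAl => /eqP.
rewrite subr_eq0 => /eqP vE; apply/rowP => j; rewrite mxE.
apply: (@discounted_fixpoint_eq _ _ beta P (fun=> 0) (v 0) (fun=> 0)) => // i.
  (* The left side is rewritten as an entry of [trmx v] so that [vE] applies. *)
  rewrite add0r -[LHS](mxE trmx_key (fun i j => v j i)) -/(trmx v) vE !mxE.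
  by congr (_ * _); apply: eq_bigr => k _; rewrite mxE.
by rewrite big1 ?mulr0 ?addr0 // => k _; rewrite mulr0.
Qed.

Lemma min_action_le (R : realType) (S A : nat) (Q : 'M[R]_(S.+1, A.+1)) j b :
  min_action Q j <= Q j b.
Proof. exact: bigmin_le. Qed.

Lemma min_action_attained (R : realType) (S A : nat)
    (Q : 'M[R]_(S.+1, A.+1)) j :
  exists b, min_action Q j = Q j b.
Proof.
rewrite /min_action; elim/big_ind: _ => [|x y [a ->] [b ->]|b _].
- by exists ord0.
- by case: leP => _; [exists a | exists b].
- by exists b.
Qed.

Lemma policy_value_fixpoint (R : realType) (S A : nat)
    (p : 'I_S.+1 -> 'I_S.+1 -> 'I_A.+1 -> R) (beta : R)
    (w : 'I_S.+1 -> 'I_A.+1) (c : 'M[R]_(S.+1, A.+1)) (i : 'I_S.+1) :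
    transition_kernel p -> 0 <= beta -> beta < 1 ->
  let V := invmx (1%:M - beta *: policy_transition p w) *m policy_cost c w in
  V i 0 = c i (w i) + beta * \sum_j p i j (w i) * V j 0.
Proof.
move=> [p0 p1] b0 b1 V.
have Munit : 1%:M - beta *: policy_transition p w \in unitmx.
  apply: discounted_unitmx => // [k j|k]; first by rewrite mxE.
  by under eq_bigr do rewrite mxE; rewrite p1.
have := congr1 (fun M : 'cV_ _ => M i 0) (mulKVmx Munit (policy_cost c w)).
(* Generalizing [V] hides its body from [mxE]. *)
rewrite -/V; move: V => V; rewrite mulmxBl mul1mx -scalemxAl !mxE => <-.
by under eq_bigr do rewrite mxE; rewrite subrK.
Qed.

Theorem theorem2 (R : realType) (S A : nat)
    (p : 'I_S.+1 -> 'I_S.+1 -> 'I_A.+1 -> R) (beta : R)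
    (hp : transition_kernel p) (hbeta0 : 0 < beta) (hbeta1 : beta < 1)
    (w : 'I_S.+1 -> 'I_A.+1) (c Q : 'M[R]_(S.+1, A.+1))
    (hQ : learned_Qvalues p beta c Q) :
  policy_region w Q <->
  (forall (i : 'I_S.+1) (a : 'I_A.+1), a != w i ->
     c i a >
       ((std_basis R i - beta *: transition_vector p i a)^T
          *m invmx (1%:M - beta *: policy_transition p w)
          *m policy_cost c w) 0 0).
Proof.
have b0 := ltW hbeta0; have [p0 p1] := hp.
pose V := invmx (1%:M - beta *: policy_transition p w) *m policy_cost c w.
have VE i : V i 0 = c i (w i) + beta * \sum_j p i j (w i) * V j 0.
  exact: policy_value_fixpoint.
have condE i a :
    ((std_basis R i - beta *: transition_vector p i a)^T
      *m invmx (1%:M - beta *: policy_transition p w) *m policy_cost c w) 0 0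
    = V i 0 - beta * \sum_j p i j a * V j 0.
  rewrite -mulmxA -/V; move: {VE}V => V; rewrite linearB linearZ /=.
  rewrite /std_basis trmx_delta mulmxBl -rowE.
  rewrite -scalemxAl !mxE; congr (_ - _ * _).
  by apply: eq_bigr => j _; rewrite !mxE.
split=> [QV i a aw|cV].
  have mE j : min_action Q j = Q j (w j).
    apply/le_anti; rewrite min_action_le /=.
    have [b ->] := min_action_attained Q j.
    by have [->//|/QV/ltW] := eqVneq b (w j).
  have mV : min_action Q =1 V^~ 0.
    apply: (discounted_fixpoint_eq (c := fun i => c i (w i))
      (P := fun i j => p i j (w i)) b0 hbeta1) => // k.
    by rewrite {1}mE hQ.
  (* With [V] replaced by the minimum, the right side is the Bellman expression for [Q i a]. *)
  rewrite condE ltrBlDr -mV mE.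
  by under eq_bigr do rewrite -mV; rewrite -hQ; exact: QV.
have VleE i a : a != w i -> V i 0 < c i a + beta * \sum_j p i j a * V j 0.
  by move=> /cV; rewrite condE ltrBlDr.
have mV i : min_action Q i = V i 0.
  apply/le_anti/andP; split; rewrite -subr_le0.
    apply: (discounted_max_principle (x := fun i => min_action Q i - V i 0)
      (P := fun i j => p i j (w i)) b0 hbeta1) => // k.
    under eq_bigr do rewrite mulrBr.
    rewrite sumrB mulrBr.
    by have := min_action_le Q k (w k); rewrite hQ; have := VE k; lra.
  have /fin_all_exists[u uE] := min_action_attained Q.
  apply: (discounted_max_principle (x := fun i => V i 0 - min_action Q i)
    (P := fun i j => p i j (u i)) b0 hbeta1) => // k.
  (* Only a weak inequality is available: where [u k = w k] the two sides agree by [VE], elsewhere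
     the condition applies. *)
  have Vu : V k 0 <= c k (u k) + beta * \sum_j p k j (u k) * V j 0.
    by have [->|/VleE/ltW//] := eqVneq (u k) (w k); rewrite -VE.
  under eq_bigr do rewrite mulrBr.
  by rewrite sumrB mulrBr; have := uE k; rewrite hQ; lra.
(* Hence [Q i (w i) = V i 0], and the condition [VleE] is membership in the region. *)
have QE i a : Q i a = c i a + beta * \sum_j p i j a * V j 0.
  by rewrite hQ; under eq_bigr do rewrite mV.
by move=> i a aw; rewrite !QE -VE; exact: VleE.
Qed.
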